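(* Let $(\Gamma,\pi)$ be a weighted graph with $\Gamma=(G,E)$, and let $\rho$ be a metric on $\Gamma$ (i.e. on the vertex set $G$) satisfying the following two conditions: (i) there exists $c_\rho>0$ such that $\rho(x,y)\le c_\rho$ whenever $x\sim y$; (ii) there exists $C_\rho>0$ such that $\sum_{y\sim x}\pi_{xy}\rho^2(x,y)\le C_\rho$ for each $x\in G$. Denote by $B_\rho(x,r)$ the closed ball of radius $r$ centered at $x$ in the metric $\rho$, and let $|\cdot|$ denote counting measure. If there exist $x_0\in G$ and $r_0\ge 0$ such that $$\int_{r_0}^\infty \frac{r}{\log|B_\rho(x_0,r)|}\,dr=+\infty,$$ then $(\Gamma,\pi)$ is stochastically complete.
   Context: $\Gamma=(G,E)$ is an unoriented, connected, finite or countably infinite, locally finite graph without loops or multiple edges; $x\sim y$ means $\{x,y\}\in E$. A weighted graph $(\Gamma,\pi)$ has symmetric nonnegative edge weights $\pi_{xy}=\pi_{yx}$, with $\pi_{xy}>0$ if and only if $\{x,y\}\in E$; $\pi_x=\sum_{y}\pi_{xy}$. The variable-speed random walk (VSRW) $(X_t)_{t\ge0}$ is the (possibly exploding) continuous-time Markov chain on $G$ with generator $(\mathcal L_Xf)(x)=\sum_{y\sim x}\pi_{xy}(f(y)-f(x))$: from $x$ it waits an exponential time of parameter $\pi_x$ and then jumps to $y$ with probability $\pi_{xy}/\pi_x$. With $p_t(x,y)=\mathbb P^x(X_t=y)$, $(\Gamma,\pi)$ is stochastically complete if $\sum_{y\in G}p_t(x,y)=1$ for all $t\ge0$ and $x\in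 G$; equivalently, $X$ almost surely does not explode. *)

(* Defs.v *)
From HB Require Import structures.
From mathcomp Require Import all_boot all_order all_algebra.
From mathcomp Require Import all_classical all_reals all_analysis.
From mathcomp Require Import measurable_realfun.

Set Implicit Arguments.
Unset Strict Implicit.
Unset Printing Implicit Defensive.

Import Order.TTheory GRing.Theory Num.Theory.
Import numFieldNormedType.Exports.

Local Open Scope classical_set_scope.
Local Open Scope ring_scope.

Record weighted_graph (R : realType) := WeightedGraph {
  vertex :> countType;
  edge : rel vertex;
  edge_sym : symmetric edge;
  edge_irr : irreflexive edge;
  edge_connected : forall x y : vertex,
    exists p : seq vertex, path edge x p /\ last x p = y;
  edge_locally_finite : forall x : vertex, finite_set [set y | edge x y];
  weight : vertex -> vertex -> R;
  weight_ge0 : forall x y : vertex, 0 <= weight x y;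
  weight_sym : forall x y : vertex, weight x y = weight y x;
  weight_gt0 : forall x y : vertex, 0 < weight x y <-> edge x y }.

Arguments edge {R w}.
Arguments weight {R w}.

Section weighted_graph_theory.
Context {R : realType} (Gamma : weighted_graph R).

Definition neighbors (x : Gamma) : set Gamma := [set y | edge x y].

Definition vertex_weight (x : Gamma) : R :=
  \sum_(y \in neighbors x) weight x y.

(* [vertex_weight x = 0] only happens on the one-vertex graph, where the walk
   never moves: the jump chain is then taken to stay put. *)
Definition jump_prob (x y : Gamma) : R :=
  if vertex_weight x == 0 then (x == y)%:R else weight x y / vertex_weight x.

(* [Y n] is the n-th vertex visited by the walk started at [x], and [S n] the
   time spent there. The last field is the joint law of the two sequences: [Y]
   is a Markov chain with transition matrix [jump_prob], and given [Y] the
   [S n] are independent, exponential of parameter [vertex_weight (Y n)].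
   Holding times are extended reals so that parameter 0 gives [+oo]. *)
Record is_vsrw (x : Gamma) (d : measure_display) (Omega : measurableType d)
    (P : probability Omega R) (Y : nat -> Omega -> Gamma)
    (S : nat -> Omega -> \bar R) : Prop := IsVSRW {
  vsrw_measurable_site : forall n y, measurable [set w | Y n w = y];
  vsrw_measurable_time : forall n, measurable_fun [set: Omega] (S n);
  vsrw_time_ge0 : forall n w, (0 <= S n w)%E;
  vsrw_law : forall (n : nat) (y : nat -> Gamma) (t : nat -> R),
    (forall i, 0 <= t i) ->
    P [set w | forall i, (i <= n)%N -> Y i w = y i /\ ((t i)%:E < S i w)%E] =
    ((y 0%N == x)%:R *
     \prod_(0 <= i < n) jump_prob (y i) (y i.+1) *
     \prod_(0 <= i < n.+1) expR (- (vertex_weight (y i) * t i)))%:E }.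

(* The event X_t = y. Past the explosion time, i.e. the supremum of the jump
   times \sum_(i < n) S i, the walk is at no vertex. *)
Definition vsrw_at (Omega : Type) (Y : nat -> Omega -> Gamma)
    (S : nat -> Omega -> \bar R) (t : R) (y : Gamma) : set Omega :=
  [set w | exists n, Y n w = y /\
    (\sum_(0 <= i < n) S i w <= t%:E < \sum_(0 <= i < n.+1) S i w)%E].

(* The p_t(x, y) depend only on the law of the walk, so they can be computed on
   any realization. *)
Definition stochastically_complete : Prop :=
  forall (x : Gamma) (d : measure_display) (Omega : measurableType d)
    (P : probability Omega R) (Y : nat -> Omega -> Gamma)
    (S : nat -> Omega -> \bar R),
  is_vsrw x P Y S ->
  forall t : R, 0 <= t -> \esum_(y in [set: Gamma]) P (vsrw_at Y S t y) = 1%E.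

End weighted_graph_theory.

Record is_metric (R : realType) (T : Type) (rho : T -> T -> R) : Prop := IsMetric {
  metric_ge0 : forall x y, 0 <= rho x y;
  metric_eq0 : forall x y, rho x y = 0 <-> x = y;
  metric_sym : forall x y, rho x y = rho y x;
  metric_triangle : forall x y z, rho x z <= rho x y + rho y z }.

Definition metric_ball (R : realType) (T : Type) (rho : T -> T -> R) (x : T) (r : R) :
    set T :=
  [set y | rho x y <= r].

(* Extended-real conventions: an infinite ball gives r / +oo = 0, and a
   one-point ball gives r / 0 = +oo for r > 0. *)
Definition growth_integrand (R : realType) (T : choiceType) (rho : T -> T -> R)
    (x : T) (r : R) : \bar R :=
  (r%:E / lne (counting (metric_ball rho x r)))%E.

(* The integral of r / log |B(x0, r)| diverges at infinity. Since r / log 1 is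
   undefined, the integral has to start where the ball has at least two points
   (otherwise, with r / 0 = +oo, it could diverge at finite r and say nothing
   about growth); this is waived on a one-point space, where every ball is a
   singleton. *)
Definition growth_diverges (R : realType) (T : choiceType) (rho : T -> T -> R)
    (x0 : T) (r0 : R) : Prop :=
  (metric_ball rho x0 r0 = [set x0] -> [set: T] = [set x0]) /\
  (\int[lebesgue_measure]_(r in `[r0, +oo[) growth_integrand rho x0 r = +oo)%E.

(* Main.v *)
Require Import Defs.
From HB Require Import structures.
From mathcomp Require Import all_boot all_order all_algebra.
From mathcomp Require Import finmap.
From mathcomp Require Import all_classical all_reals all_analysis.
From mathcomp Require Import measurable_realfun.
From mathcomp Require Import ring lra.

(* Let u(x) = E^x[exp(- zeta)], zeta being the explosion time. It solves L u = u
   with 0 <= u <= 1, and P^x(zeta <= t) <= exp(t) u(x), so the theorem reduces to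
   a Liouville property: a bounded u >= 0 with u <= L u vanishes.

   Test the equation against u^q psi, with psi = exp(- kappa rho(x0, .)). On each
   edge the error is at most of order kappa^2 rho^2 / q, even for long jumps, so
   the adapted metric allows kappa of order sqrt q. Since every vertex has mass 1,
   comparing the balls of radii r and 2 r gives, with M(s) the supremum of u over
   the ball of radius s,
     M(r)^(q+1) <= 2 |B(2 r)| M(2 r)^(q+1) exp(- theta sqrt q r / 2).
   For q of order (log |B(2 r)| / r)^2 this yields
     log (M(2 r) / M(r)) >= cst * r^2 / log |B(2 r)|.
   Along r = 2^k R0 the left-hand sides have a bounded sum when u is not 0, while
   the right-hand sides add up to the divergent integral. *)

Set Implicit Arguments.
Unset Strict Implicit.
Unset Printing Implicit Defensive.

Import Order.TTheory GRing.Theory Num.Theory.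
Import numFieldNormedType.Exports.

Local Open Scope classical_set_scope.
Local Open Scope ring_scope.

(** * Liouville property *)

(* Along an edge the test function [u ^ q * psi] can only lose when [b / a] is
   close to 1 (otherwise the left-hand side is negative), so the bound is
   quadratic in [h] and gains [1 / q], however large the jump is. *)
Lemma edge_bound (R : realType) (q : nat) (h a b s t : R) :
  (0 < q)%N -> 0 <= h <= q%:R -> 0 <= a <= b -> 0 <= t ->
  s <= expR h * t -> 0 <= s ->
  (b - a) * (a ^+ q * s - b ^+ q * t) <=
  expR 1 * h ^+ 2 / q%:R * (a ^+ q.+1 * s).
Proof.
move=> q0 /andP[h0 hq] /andP[a0 ab] t0 st s0.
have q0' : 0 < q%:R :> R by rewrite ltr0n.
have RHS0 : 0 <= expR 1 * h ^+ 2 / q%:R * (a ^+ q.+1 * s).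
  by rewrite !mulr_ge0 ?expR_ge0 ?invr_ge0 ?exprn_ge0// ltW.
have [le|lt] := leP (a ^+ q * s) (b ^+ q * t).
  by apply: le_trans RHS0; rewrite mulr_ge0_le0 ?subr_ge0 ?subr_le0.
have {a0}a0 : 0 < a.
  rewrite lt_neqAle a0 andbT eq_sym; apply/eqP => a00.
  move: lt; rewrite a00 expr0n gtn_eqF// mul0r ltNge mulr_ge0//.
  by rewrite exprn_ge0// -a00.
have t1 : 0 < t.
  rewrite lt_neqAle t0 andbT eq_sym; apply/eqP => t00; move: lt st.
  rewrite t00 !mulr0 => /[swap] s0'.
  by rewrite (_ : s = 0) ?mulr0 ?ltxx//; apply/eqP; rewrite eq_le s0 s0'.
set z := ln (b / a).
have b0 : 0 < b by exact: lt_le_trans ab.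
have bE : b = a * expR z.
  by rewrite /z lnK ?posrE ?divr_gt0// mulrCA divff ?mulr1// gt_eqF.
have z0 : 0 <= z by rewrite /z ln_ge0// ler_pdivlMr// mul1r.
have qz : q%:R * z < h.
  rewrite -ltr_expR -(ltr_pM2r t1); apply: lt_le_trans st.
  have aq : 0 < a ^+ q by rewrite exprn_gt0.
  rewrite -(ltr_pM2l aq); apply: le_lt_trans lt.
  by rewrite bE exprMn -expRM_natl mulrA.
have z1 : z <= 1.
  rewrite -(ler_pM2l q0') mulr1; apply: le_trans hq; exact: ltW.
have st' : expR (- h) * s <= t by rewrite expRN mulrC ler_pdivrMr ?expR_gt0// mulrC.
have H1 : a ^+ q * s - b ^+ q * t <= (a ^+ q * s) * (h - q%:R * z).
  have -> : b ^+ q = a ^+ q * expR (q%:R * z) by rewrite bE exprMn -expRM_natl.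
  rewrite -!mulrA -mulrBr ler_wpM2l ?exprn_ge0 ?(ltW a0)//.
  rewrite lerBlDr -lerBlDl.
  apply: (@le_trans _ _ (expR (q%:R * z) * (expR (- h) * s))); last first.
    by rewrite ler_wpM2l ?expR_ge0.
  rewrite mulrA -expRD -[X in X - _]mulr1 -mulrBr mulrC ler_wpM2r//.
  have := expR_ge1Dx (q%:R * z - h); lra.
have H2 : b - a <= a * (z * expR 1).
  rewrite bE -[X in _ - X]mulr1 -mulrBr ler_wpM2l ?(ltW a0)//.
  apply: (@le_trans _ _ (z * expR z)); last by rewrite ler_wpM2l// ler_expR.
  have -> : expR z - 1 = (1 - expR (- z)) * expR z.
    by rewrite mulrBl mul1r -expRD addNr expR0.
  rewrite ler_wpM2r ?expR_ge0//; have := expR_ge1Dx (- z); lra.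
apply: (@le_trans _ _ (a * (z * expR 1) * (a ^+ q * s * (h - q%:R * z)))).
  apply: ler_pM => //; rewrite subr_ge0// ltW//.
have -> : a * (z * expR 1) * (a ^+ q * s * (h - q%:R * z)) =
  expR 1 * (z * (h - q%:R * z)) * (a ^+ q.+1 * s) by rewrite exprS; ring.
rewrite ler_wpM2r ?mulr_ge0 ?exprn_ge0 ?(ltW a0)//.
rewrite -mulrA ler_wpM2l ?expR_ge0// ler_pdivlMr//.
have := sqr_ge0 (h - 2 * (q%:R * z)).
have := sqr_ge0 h.
rewrite !expr2; nra.
Qed.

(** Summation by parts on a finite set: exchanging [x] and [y] and averaging turns the left side of
    the equation into a sum over ordered pairs, where an edgewise bound applies. The same symmetry
    collects the errors into [g x] times the local energy at [x], which is at most [C]. *)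
Lemma green_bound (R : realType) (T : choiceType) (s : seq T)
    (w r : T -> T -> R) (u f g : T -> R) (K C : R) :
  (forall x y, w x y = w y x) -> (forall x y, 0 <= w x y) ->
  (forall x y, r x y = r y x) -> 0 <= K ->
  (forall x, 0 <= g x) ->
  (forall x, x \in s -> f x * u x <= f x * \sum_(y <- s) w x y * (u y - u x)) ->
  (forall x y, x \in s -> y \in s ->
     w x y * ((u y - u x) * (f x - f y)) <=
     w x y * (K * r x y ^+ 2 * (g x + g y))) ->
  (forall x, x \in s -> \sum_(y <- s) w x y * r x y ^+ 2 <= C) ->
  \sum_(x <- s) f x * u x <= K * C * \sum_(x <- s) g x.
Proof.
move=> wC w0 rC K0 g0 fu fg rwC.
have sym (F : T -> T -> R) : \sum_(x <- s) \sum_(y <- s) F x y =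
    \sum_(x <- s) \sum_(y <- s) F y x by rewrite exchange_big.
have greenE : 2 * \sum_(x <- s) (f x * \sum_(y <- s) w x y * (u y - u x)) =
    \sum_(x <- s) \sum_(y <- s) w x y * ((u y - u x) * (f x - f y)).
  under eq_bigr do rewrite mulr_sumr.
  rewrite mulr_natl mulr2n {2}sym -big_split/=; apply: eq_bigr => x _.
  rewrite -big_split/=; apply: eq_bigr => y _; rewrite (wC y x); ring.
have energyE : 2 * (K * \sum_(x <- s) g x * \sum_(y <- s) w x y * r x y ^+ 2) =
    \sum_(x <- s) \sum_(y <- s) w x y * (K * r x y ^+ 2 * (g x + g y)).
  rewrite mulr_natl mulr_sumr.
  under eq_bigr do rewrite mulrA mulr_sumr.
  rewrite mulr2n {2}sym -big_split/=; apply: eq_bigr => x _.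
  rewrite -big_split/=; apply: eq_bigr => y _; rewrite (wC y x) (rC y x); ring.
apply: (@le_trans _ _ (\sum_(x <- s) (f x * \sum_(y <- s) w x y * (u y - u x)))).
  by rewrite big_seq [leRHS]big_seq; apply: ler_sum => x; exact: fu.
apply: (@le_trans _ _ (K * \sum_(x <- s) g x * \sum_(y <- s) w x y * r x y ^+ 2)).
  rewrite -(@ler_pM2l _ 2)// greenE energyE.
  rewrite big_seq [leRHS]big_seq; apply: ler_sum => x xs.
  by rewrite big_seq [leRHS]big_seq; apply: ler_sum => y ys; exact: fg.
rewrite -mulrA ler_wpM2l// mulr_sumr big_seq [leRHS]big_seq.
by apply: ler_sum => x xs; rewrite mulrC ler_wpM2r// rwC.
Qed.

Lemma weight_eq0 (R : realType) (Gamma : weighted_graph R) (x y : Gamma) :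
  ~~ edge x y -> weight x y = 0.
Proof.
move=> xy; apply/eqP; rewrite eq_le weight_ge0 andbT leNgt.
by apply: contra xy => /weight_gt0.
Qed.

Lemma sum_neighbors (R : realType) (Gamma : weighted_graph R) (x : Gamma)
    (s : seq Gamma) (F : Gamma -> R) :
  uniq s -> (forall y, edge x y -> y \in s) ->
  \sum_(y \in neighbors x) weight x y * F y = \sum_(y <- s) weight x y * F y.
Proof.
move=> us xs; rewrite [RHS]fsbig_seq//; apply: fsbig_widen => [y|y]; first exact: xs.
by move=> [_ /negP xy] /=; rewrite weight_eq0 ?mul0r.
Qed.

(** Near the boundary of a ball [s] some neighbors of [x] are missing; an upper bound for the local
    energy is enough there. *)
Lemma le_sum_neighbors (R : realType) (Gamma : weighted_graph R) (x : Gamma)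
    (s : seq Gamma) (F : Gamma -> R) :
  uniq s -> (forall y, 0 <= F y) ->
  \sum_(y <- s) weight x y * F y <= \sum_(y \in neighbors x) weight x y * F y.
Proof.
move=> us F0; pose N := enum_fset (fset_set (neighbors x)).
have Nfin : finite_set (neighbors x) by exact: edge_locally_finite.
have NE y : (y \in N) = edge x y.
  by rewrite /N in_fset_set//; apply/idP/idP; rewrite inE.
have uN : uniq N by exact: fset_uniq.
rewrite (@sum_neighbors _ _ _ (undup (s ++ N)))//; last 2 first.
  exact: undup_uniq.
  by move=> y xy; rewrite mem_undup mem_cat NE xy orbT.
rewrite undup_cat big_cat/= (undup_id uN).
have -> : \sum_(y <- s) weight x y * F y =
    \sum_(y <- [seq z <- undup s | z \notin N]) weight x y * F y +
    \sum_(y <- [seq z <- s | z \in N]) weight x y * F y.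
  rewrite (bigID (mem N))/= addrC !big_filter undup_id//.
rewrite lerD2l.
have -> : \sum_(y <- [seq z <- s | z \in N]) weight x y * F y =
    \sum_(y <- [seq z <- N | z \in s]) weight x y * F y.
  apply: perm_big; apply: uniq_perm; rewrite ?filter_uniq//.
  by move=> y; rewrite !mem_filter andbC.
rewrite big_filter [leRHS](bigID (mem s))/= lerDl sumr_ge0// => y _.
by rewrite mulr_ge0 ?weight_ge0.
Qed.

(** The exponent is a square, [q = n ^ 2], so that the spatial rate [theta * n] is [theta] times an
    exact square root of [q]. The smallness of [theta] makes the error in Green's formula at most
    half of the sum of [g], which absorbs it; what remains comes from the truncation level [e]. *)
Lemma subsolution_growth (R : realType) (Gamma : weighted_graph R)
    (rho : Gamma -> Gamma -> R) (c C theta r M : R) (x0 : Gamma)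
    (u : Gamma -> R) (n : nat) (B := metric_ball rho x0 (2 * r)) :
  is_metric rho ->
  (forall x y : Gamma, edge x y -> rho x y <= c) ->
  (forall x : Gamma, \sum_(y \in neighbors x) weight x y * rho x y ^+ 2 <= C) ->
  0 < theta -> theta * c <= 1 -> 0 <= C -> expR 1 * theta ^+ 2 * C <= 2^-1 ->
  (forall x, 0 <= u x) ->
  (forall x, u x <= \sum_(y \in neighbors x) weight x y * (u y - u x)) ->
  0 <= r -> 2 * c <= r -> finite_set B ->
  (forall x, B x -> u x <= M) -> (0 < n)%N ->
  forall x, rho x0 x <= r ->
  u x ^+ (n ^ 2).+1 <=
    2 * #|` fset_set B|%:R * M ^+ (n ^ 2).+1 * expR (- (theta * n%:R * r / 2)).
Proof.
move=> [d0 dE dC dT] rc rC th0 thc C0 thC u0 Lu r0 cr finB uM n0.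
set q := (n ^ 2)%N; set N := #|` fset_set B|.
have q0 : (0 < q)%N by rewrite expn_gt0 n0.
pose k := theta * n%:R; pose psi x := expR (- (k * rho x0 x)).
have k0 : 0 < k by rewrite mulr_gt0// ltr0n.
pose s := enum_fset (fset_set B).
have sE x : (x \in s) = (rho x0 x <= 2 * r).
  by rewrite /s in_fset_set//; apply/idP/idP; rewrite inE.
have us : uniq s by exact: fset_uniq.
have x0s : x0 \in s by rewrite sE (dE x0 x0).2// mulr_ge0.
have M0 : 0 <= M by rewrite (le_trans (u0 x0))// uM//; move: x0s; rewrite sE.
(* Truncating at the level e, rather than in space only, makes f vanish
   continuously at the boundary: outside the ball of radius 3 r / 2 one has
   u ^ q * psi <= e anyway. *)
pose e := M ^+ q * expR (- (k * (3 / 2 * r))).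
have e0 : 0 <= e by rewrite mulr_ge0 ?exprn_ge0 ?expR_ge0.
pose in_ x := (rho x0 x <= 3 / 2 * r) && (e < u x ^+ q * psi x).
pose f x := if in_ x then u x ^+ q * psi x - e else 0.
pose g x := if in_ x then u x ^+ q.+1 * psi x else 0.
have psi0 x : 0 < psi x by exact: expR_gt0.
have f0 x : 0 <= f x.
  by rewrite /f; case: ifP => // /andP[_ /ltW]; rewrite subr_ge0.
have g0 x : 0 <= g x.
  by rewrite /g; case: ifP => // _; rewrite mulr_ge0 ?exprn_ge0 ?(ltW (psi0 x)).
have fge y : y \in s -> u y ^+ q * psi y - e <= f y.
  move=> ys; rewrite /f /in_; case: ifPn => //; rewrite negb_and.
  case/orP; last by rewrite -leNgt subr_le0.
  rewrite -ltNge => /ltW yr; rewrite subr_le0 /e ler_pM ?exprn_ge0 ?(ltW (psi0 y))//.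
    by apply: lerXn2r; rewrite ?nnegrE// uM// /B/metric_ball/= -sE.
  by rewrite /psi ler_expR lerN2 ler_wpM2l// ltW.
pose K := expR 1 * theta ^+ 2.
have K0 : 0 <= K by rewrite mulr_ge0 ?expR_ge0 ?sqr_ge0.
(* The left-hand side is symmetric in [x] and [y], so one direction is enough. Truncation does no
   harm: by [fge], [f y] is at least [u y ^+ q * psi y - e], and the two levels [e] cancel. *)
have half x y : x \in s -> y \in s -> edge x y -> u x <= u y ->
    (u y - u x) * (f x - f y) <= K * rho x y ^+ 2 * g x.
  move=> xs ys xy uxy.
  have RHS0 : 0 <= K * rho x y ^+ 2 * g x.
    by apply: mulr_ge0 => //; apply: mulr_ge0 => //; exact: sqr_ge0.
  case: (boolP (in_ x)) => [inx|ninx]; last first.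
    apply: le_trans RHS0; rewrite mulr_ge0_le0 ?subr_ge0 ?subr_le0//.
    by rewrite {1}/f (negbTE ninx).
  apply: (@le_trans _ _ ((u y - u x) * (u x ^+ q * psi x - u y ^+ q * psi y))).
    rewrite ler_wpM2l ?subr_ge0//; have := fge y ys; rewrite {2}/f inx; lra.
  have := @edge_bound R q (k * rho x y) (u x) (u y) (psi x) (psi y) q0.
  have -> : 0 <= k * rho x y <= q%:R.
    rewrite mulr_ge0 ?(ltW k0)//= /k /q natrX expr2 -mulrA mulrCA ler_wpM2l//.
    apply: (@le_trans _ _ 1); last by rewrite ler1n.
    by rewrite (le_trans _ thc)// ler_wpM2l ?(ltW th0)// rc.
  rewrite uxy u0 (ltW (psi0 x)) (ltW (psi0 y)) /= => H.
  apply: le_trans (H isT isT isT _ isT) _.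
    rewrite /psi -expRD ler_expR -mulrN -mulrN -mulrDr ler_wpM2l ?(ltW k0)//.
    by have := dT x0 x y; lra.
  rewrite /g inx exprMn /k exprMn /q natrX /K.
  have nn : n%:R != 0 :> R by rewrite pnatr_eq0 -lt0n.
  by move: (u x ^+ _ * psi x) => X; rewrite le_eqVlt; apply/orP; left; apply/eqP; field.
have energy : \sum_(x <- s) f x * u x <= K * C * \sum_(x <- s) g x.
  apply: (@green_bound _ _ s weight rho) => //; first exact: weight_sym.
  - exact: weight_ge0.
  - move=> x xs; case: (boolP (in_ x)) => [inx|ninx]; last first.
      by rewrite /f (negbTE ninx) !mul0r.
    (* As [c <= r / 2], the neighbors of a point at distance at most 3 r / 2 lie in [s], so no term
       of the equation is lost. *)
    rewrite ler_wpM2l// -sum_neighbors//.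
    move=> y xy; rewrite sE (le_trans (dT _ x _))//.
    by move/andP: inx => [+ _]; have := rc _ _ xy; lra.
  - move=> x y xs ys; case: (boolP (edge x y)) => [xy|/weight_eq0->]; last first.
      by rewrite !mul0r.
    rewrite ler_wpM2l ?weight_ge0//.
    have Kr0 : 0 <= K * rho x y ^+ 2 by apply: mulr_ge0 => //; exact: sqr_ge0.
    have [uxy|/ltW uyx] := leP (u x) (u y).
      by rewrite (le_trans (half _ _ xs ys xy uxy))// ler_wpM2l// lerDl.
    have yx : edge y x by rewrite edge_sym.
    have := half _ _ ys xs yx uyx; rewrite -mulrNN !opprB (dC y x) => /le_trans.
    by apply; rewrite ler_wpM2l// lerDr.
  - move=> x xs; apply: le_trans (rC x).
    by apply: le_sum_neighbors => // y; exact: sqr_ge0.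
have gE x : g x = f x * u x + e * (if in_ x then u x else 0).
  rewrite /g /f; case: ifP => _; last by rewrite mul0r mulr0 addr0.
  by rewrite exprS; ring.
have sumg : \sum_(x <- s) g x <= 2 * e * M * N%:R.
  have H1 : \sum_(x <- s) g x <=
      2^-1 * \sum_(x <- s) g x + e * (M * N%:R).
    rewrite {1}(eq_bigr _ (fun x _ => gE x)) big_split/= lerD//.
      by rewrite (le_trans energy)// ler_wpM2r ?sumr_ge0.
    rewrite -mulr_sumr ler_wpM2l//.
    have -> : M * N%:R = \sum_(x <- s) M.
      by rewrite big_const_seq count_predT iter_addr_0 mulr_natr.
    rewrite big_seq [leRHS]big_seq; apply: ler_sum => x; rewrite sE => xs.
    by case: ifP => _ //; exact: uM.
  lra.
move=> x xr.
have rr : r <= 2 * r by lra.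
have xs : x \in s by rewrite sE (le_trans xr).
have psix : expR (- (k * r)) <= psi x.
  by rewrite /psi ler_expR lerN2 ler_wpM2l// ltW.
have N1 : 1 <= N%:R :> R.
  by rewrite ler1n cardfs_gt0; apply/fset0Pn; exists x0.
have main : u x ^+ q.+1 * psi x <= 2 * e * M * N%:R.
  case: (boolP (in_ x)) => [inx|].
    apply: le_trans sumg; rewrite (big_rem x)//= {1}/g inx lerDl sumr_ge0//.
  rewrite negb_and -ltNge -leNgt => /orP[|le].
    by move=> /lt_le_trans/(_ xr); lra.
  have ux : u x <= M by apply: uM; rewrite /B/metric_ball/= -sE.
  apply: (@le_trans _ _ (M * e)).
    by rewrite exprS -mulrA ler_pM// ?mulr_ge0// ?exprn_ge0// ltW.
  have eM : 0 <= e * M by rewrite mulr_ge0.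
  have := ler_wpM2l eM N1; lra.
(* The level [e] carries the decay at radius 3 r / 2, and dividing by [psi x] costs at most the
   decay at radius r; the gain k r / 2 is the difference. *)
have E : 2 * N%:R * M ^+ q.+1 * expR (- (k * r / 2)) =
    (2 * e * M * N%:R) * expR (k * r).
  rewrite /e exprS.
  have -> : expR (- (k * r / 2)) = expR (- (k * (3 / 2 * r))) * expR (k * r).
    by rewrite -expRD; congr expR; field.
  by ring.
rewrite E -ler_pdivrMr ?expR_gt0// -expRN; apply: le_trans main.
by rewrite ler_wpM2l// exprn_ge0.
Qed.

(** No measurability is asked: the integral of a nonnegative function is the supremum over the
    simple functions below it. *)
Lemma le_integral_ge0 d (T : measurableType d) (R : realType)
    (mu : {measure set T -> \bar R}) (D : set T) (f g : T -> \bar R) :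
  (forall x, D x -> 0 <= f x)%E -> (forall x, D x -> f x <= g x)%E ->
  (\int[mu]_(x in D) f x <= \int[mu]_(x in D) g x)%E.
Proof.
move=> f0 fg; rewrite integral_mkcond [leRHS]integral_mkcond.
have h0 (x : T) : (0 <= (f \_ D) x)%E by apply: erestrict_ge0.
have hg (x : T) : ((f \_ D) x <= (g \_ D) x)%E by apply: lee_restrict.
have g0 (x : T) : (0 <= (g \_ D) x)%E by exact: le_trans (hg x).
rewrite !ge0_integralTE//; apply: le_ereal_sup => _ [h hf <-].
by exists h => // x; exact: le_trans (hg x).
Qed.

(** The step function with value [c k] on [[t k, t k.+1[] dominates [g]; being a series of
    indicators, it is integrated term by term. *)
Lemma integral_le_step (R : realType) (g : R -> \bar R) (r0 : R)
    (t c : nat -> R) (D : R) :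
  t 0 = r0 -> (forall k, t k <= t k.+1) -> (forall r, exists k, r < t k) ->
  (forall k, 0 <= c k) ->
  (forall k r, t k <= r < t k.+1 -> (0 <= g r <= (c k)%:E)%E) ->
  (forall K, \sum_(0 <= k < K) c k * (t k.+1 - t k) <= D) ->
  (\int[lebesgue_measure]_(r in `[r0, +oo[) g r <= D%:E)%E.
Proof.
move=> t0 tle tun c0 gc cD.
pose m (k : nat) (r : R) : \bar R := ((c k)%:E * (\1_(`[t k, t k.+1[) r)%:E)%E.
have m0 k r : (0 <= m k r)%E by rewrite mule_ge0 ?lee_fin.
have ex r : r0 <= r -> exists k, t k <= r < t k.+1.
  move=> r0r; case: (ex_minnP (tun r)) => -[|k] kr kmin.
    by move: kr; rewrite t0 ltNge r0r.
  by exists k; rewrite kr andbT leNgt; apply/negP => /kmin; rewrite ltnn.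
have gm r : `[r0, +oo[%classic r -> (0 <= g r /\ g r <= \sum_(k <oo) m k r)%E.
  rewrite /= in_itv/= andbT => /ex[k kr].
  have /andP[gr0 grc] := gc _ _ kr; split => //.
  apply: (le_trans grc).
  apply: (@le_trans _ _ (\sum_(0 <= i < k.+1) m i r)%E); last first.
    exact: nneseries_lim_ge.
  rewrite big_nat_recr//= -[leLHS]add0e leeD ?sume_ge0//.
  by rewrite /m indicE mem_set ?mule1//= in_itv.
apply: (@le_trans _ _
    (\int[lebesgue_measure]_(r in `[r0, +oo[) \sum_(k <oo) m k r)%E).
  by apply: le_integral_ge0 => r /gm[].
rewrite integral_nneseries//; last first.
  move=> k; apply: measurable_funTS; apply: emeasurable_funM => //.
  by apply/measurable_EFinP; exact: measurable_indic.
apply: lime_le; first by apply: is_cvg_nneseries => k _ _; apply: integral_ge0.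
apply: nearW => K; apply: (@le_trans _ _ (\sum_(0 <= k < K) c k * (t k.+1 - t k))%:E).
  rewrite -sumEFin; apply: lee_sum => k _.
  rewrite ge0_integralZl ?lee_fin//; last first.
    by apply/measurable_funTS/measurable_EFinP; exact: measurable_indic.
  rewrite EFinM lee_wpmul2l ?lee_fin// integral_indic//.
  apply: (@le_trans _ _ (lebesgue_measure `[t k, t k.+1[%classic)).
    by apply: le_measure; rewrite ?inE//; exact: measurableI.
  rewrite lebesgue_measure_itv/= lte_fin; case: ifPn => // _.
  by rewrite lee_fin subr_ge0.
by rewrite lee_fin.
Qed.

(** Half of the gain theta n r / 2 pays for the volume factor. The root of order n^2 + 1 <= 2 n^2 of
    the other half leaves a decay of at least theta r / (8 n), and the [+ 1] in the statement comes
    from rounding [n] up. *)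
Lemma subsolution_decay (R : realType) (Gamma : weighted_graph R)
    (rho : Gamma -> Gamma -> R) (c C theta r M : R) (x0 : Gamma)
    (u : Gamma -> R) (B := metric_ball rho x0 (2 * r))
    (L := ln (2 * #|` fset_set B|%:R)) :
  is_metric rho ->
  (forall x y : Gamma, edge x y -> rho x y <= c) ->
  (forall x : Gamma, \sum_(y \in neighbors x) weight x y * rho x y ^+ 2 <= C) ->
  0 < theta -> theta * c <= 1 -> 0 <= C -> expR 1 * theta ^+ 2 * C <= 2^-1 ->
  (forall x, 0 <= u x) ->
  (forall x, u x <= \sum_(y \in neighbors x) weight x y * (u y - u x)) ->
  0 < r -> 2 * c <= r -> finite_set B ->
  (forall x, B x -> u x <= M) ->
  forall x, rho x0 x <= r ->
  u x <= M * expR (- (theta * r / (8 * (4 * L / (theta * r) + 1)))).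
Proof.
move=> rhoM rc rC th0 thc C0 thC u0 Lu r0 cr finB uM x xr.
have tr0 : 0 < theta * r by rewrite mulr_gt0.
have x0B : B x0 by rewrite /B/metric_ball/= (metric_eq0 rhoM x0 x0).2// mulr_ge0// ltW.
have N1 : 1 <= #|` fset_set B|%:R :> R.
  by rewrite ler1n cardfs_gt0; apply/fset0Pn; exists x0; rewrite in_fset_set// inE.
have L0 : 0 < L by rewrite /L ln_gt0//; lra.
have M0 : 0 <= M by rewrite (le_trans (u0 x0))// uM.
(* this n makes the volume factor at most half of the exponential gain *)
pose n := `|Num.ceil (4 * L / (theta * r))|%N.
have q0 : 0 < 4 * L / (theta * r) by rewrite divr_gt0// mulr_gt0.
have nE : n%:R = (Num.ceil (4 * L / (theta * r)))%:~R :> R.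
  by rewrite /n natr_absz ger0_norm// ltW// ceil_gt0.
have nge : 4 * L / (theta * r) <= n%:R by rewrite nE ceil_ge.
have nlt : n%:R < 4 * L / (theta * r) + 1.
  by rewrite nE -ltrBlDr; have := ceil_itv (4 * L / (theta * r)); rewrite intrD => /andP[].
have n0 : (0 < n)%N by rewrite -(ltr_nat R) (lt_le_trans q0).
have := subsolution_growth rhoM rc rC th0 thc C0 thC u0 Lu (ltW r0) cr finB uM n0 xr.
set p := (n ^ 2).+1; set eta := theta * r / _.
have n0' : 1 <= n%:R :> R by rewrite ler1n.
have eta_le : p%:R * eta <= theta * n%:R * r / 4.
  have pn : p%:R <= 2 * (n%:R * n%:R) :> R by rewrite -!natrM ler_nat /p -mulnn -addn1 mul2n -addnn leq_add2l muln_gt0 n0.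
  rewrite /eta mulrA ler_pdivrMr; last by rewrite mulr_gt0// addr_gt0.
  apply: (@le_trans _ _ (2 * (n%:R * n%:R) * (theta * r))); first by rewrite ler_pM2r.
  have -> X : theta * n%:R * r / 4 * (8 * X) = 2 * (n%:R * X) * (theta * r) by field.
  by rewrite ler_pM2r// ler_pM2l// ler_pM2l ?ltr0n// ltW.
have Lle : L <= theta * n%:R * r / 4.
  move: nge; rewrite ler_pdivrMr//; lra.
have ME : (M * expR (- eta)) ^+ p = M ^+ p * expR (- (p%:R * eta)).
  by rewrite exprMn -expRM_natl mulrN.
rewrite -/B => H; rewrite -(@ler_pXn2r _ p)// ?nnegrE ?mulr_ge0 ?expR_ge0//.
rewrite ME; apply: (le_trans H).
have LE : expR L = 2 * #|` fset_set B|%:R.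
  by rewrite /L lnK// posrE mulr_gt0// (lt_le_trans _ N1).
rewrite -LE mulrAC mulrC -expRD; apply: ler_wpM2l; first exact: exprn_ge0.
by rewrite ler_expR; clear H ME; lra.
Qed.

Lemma bounded_subsolution_eq0 (R : realType) (Gamma : weighted_graph R)
    (rho : Gamma -> Gamma -> R) (c C r0 : R) (x0 : Gamma) (u : Gamma -> R) :
  is_metric rho -> 0 < c -> 0 < C ->
  (forall x y : Gamma, edge x y -> rho x y <= c) ->
  (forall x : Gamma, \sum_(y \in neighbors x) weight x y * rho x y ^+ 2 <= C) ->
  0 <= r0 -> growth_diverges rho x0 r0 ->
  (forall x, 0 <= u x <= 1) ->
  (forall x, u x <= \sum_(y \in neighbors x) weight x y * (u y - u x)) ->
  forall x, u x = 0.
Proof.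
move=> rhoM c0 C0 rc rC r00 [ball1 div] u01 Lu x1.
have u0 x : 0 <= u x by case/andP: (u01 x).
have u1 x : u x <= 1 by case/andP: (u01 x).
apply/eqP; rewrite eq_le u0 andbT leNgt; apply/negP => ux1.
(* If the ball of radius [r0] is a single point, so is the graph; no neighbor is left and the
   inequality for [u] gives [u x1 <= 0]. *)
have [/ball1 GT|/eqP ball2] := eqVneq (metric_ball rho x0 r0) [set x0].
  have := Lu x1; rewrite leNgt => /negP; apply.
  suff -> : neighbors x1 = set0 by rewrite fsbig_set0.
  rewrite -subset0 => y /= x1y.
  have : [set: Gamma] x1 by []. have : [set: Gamma] y by [].
  rewrite GT => /= yx x1x; move: x1y; rewrite /neighbors /= yx x1x.
  by rewrite edge_irr.
pose V r := #|` fset_set (metric_ball rho x0 r)|.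
have [x2 x2x0 x2r] : exists2 x2, x2 <> x0 & rho x0 x2 <= r0.
  apply: contra_notP ball2 => no; apply/seteqP; split => y /=.
    by move=> yr; apply: contrapT => yx; apply: no; exists y.
  by move=> ->; rewrite /metric_ball/= (metric_eq0 rhoM x0 x0).2.
have V2 r : r0 <= r -> finite_set (metric_ball rho x0 r) -> 2 <= (V r)%:R :> R.
  move=> rr fr; rewrite ler_nat /V.
  have /fsubset_leq_card : ([fset x2; x0] `<=` fset_set (metric_ball rho x0 r))%fset.
    apply/fsubsetP => y; rewrite !inE in_fset_set// => /orP[]/eqP->; rewrite inE.
      exact: le_trans rr.
    by rewrite /metric_ball/= (metric_eq0 rhoM x0 x0).2// (le_trans r00).
  by rewrite cardfs2; move/eqP: x2x0 => ->.
have VS r r' : r <= r' -> finite_set (metric_ball rho x0 r') ->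
    finite_set (metric_ball rho x0 r) /\ (V r <= V r')%N.
  move=> rr f'.
  have sub : metric_ball rho x0 r `<=` metric_ball rho x0 r'.
    by move=> y /= /le_trans; exact.
  have f : finite_set (metric_ball rho x0 r) by exact: sub_finite_set f'.
  split => //; apply: fsubset_leq_card; apply/fsubsetP => y.
  by rewrite !in_fset_set// !inE; exact: sub.
(* theta <= 1 absorbs the square in expR 1 * theta ^+ 2 * C *)
pose theta := (1 + c + 2 * expR 1 * C)^-1.
have e0 : 0 < expR 1 :> R by exact: expR_gt0.
have eC : 0 < 2 * expR 1 * C by rewrite !mulr_gt0.
have den0 : 0 < 1 + c + 2 * expR 1 * C by rewrite !addr_gt0.
have th0 : 0 < theta by rewrite invr_gt0.
have thE : theta * (1 + c + 2 * expR 1 * C) = 1 by rewrite mulVf// gt_eqF.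
have thc : theta * c <= 1.
  by rewrite -[leRHS]thE ler_pM2l//; lra.
have th1 : theta <= 1 by rewrite invf_le1//; lra.
have thC : expR 1 * theta ^+ 2 * C <= 2^-1.
  have : theta * (2 * expR 1 * C) <= 1 by rewrite -[leRHS]thE ler_pM2l//; lra.
  have : theta * (theta * (2 * expR 1 * C)) <= theta * (2 * expR 1 * C).
    by rewrite ler_piMl// mulr_ge0// ltW.
  rewrite expr2; lra.
pose D := - ln (u x1).
have D0 : 0 <= D by rewrite oppr_ge0 ln_le0.
have uD : u x1 = expR (- D) by rewrite opprK lnK.
(* Adding [P] to [R0] makes [theta * r k / 40] exceed [D] for every [k], which rules out the case
   [L < theta * r k] below. *)
have [P P0 tP] : exists2 P, 0 <= P & theta * P = 40 * (D + 1).
  exists (40 * (D + 1) / theta); last by rewrite mulrC divfK// gt_eqF.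
  by rewrite divr_ge0 ?mulr_ge0 ?addr_ge0// ltW.
pose R0 := r0 + 2 * c + rho x0 x1 + 1 + P.
have pos2 : 0 <= rho x0 x1 by exact: metric_ge0.
have R00 : 0 < R0 by rewrite /R0; lra.
pose r k := R0 * 2 ^+ k.
have rS k : r k.+1 = 2 * r k by rewrite /r exprS; ring.
have rge k : R0 <= r k.
  by rewrite /r ler_peMr ?(ltW R00)// exprn_ege1// ler1n.
have rk0 k : 0 < r k by exact: lt_le_trans (rge k).
have r0r k : r0 <= r k by apply: le_trans (rge k); rewrite /R0; lra.
have cr k : 2 * c <= r k by apply: le_trans (rge k); rewrite /R0; lra.
have x1r k : rho x0 x1 <= r k by apply: le_trans (rge k); rewrite /R0; lra.
have Dr k : D < theta * r k / 40.
  apply: (@lt_le_trans _ _ (theta * R0 / 40)).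
    have : 0 <= theta * (r0 + 2 * c + rho x0 x1 + 1) by rewrite mulr_ge0 ?(ltW th0)//; lra.
    rewrite ltr_pdivlMr// /R0; lra.
  by rewrite ler_pM2r// ler_pM2l.
(* Guaranteed logarithmic decay of the supremum of [u] from radius [r k.+1] to radius [r k]; an
   infinite ball guarantees nothing. With Z = theta r_k <= L <= 2 ln V, the exponent Z^2 / (32 L + 8
   Z) is at least Z^2 / (80 ln V). *)
pose a k := if `[< finite_set (metric_ball rho x0 (r k.+1)) >] then
  theta ^+ 2 * r k ^+ 2 / (80 * ln (V (r k.+1))%:R) else 0.
have lnV k : finite_set (metric_ball rho x0 (r k.+1)) -> 0 < ln (V (r k.+1))%:R :> R.
  by move=> /(V2 _ (r0r _)) V2'; rewrite ln_gt0// (lt_le_trans _ V2')// ltr1n.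
have a0 k : 0 <= a k.
  rewrite /a; case: asboolP => // /lnV V0.
  by rewrite divr_ge0 ?mulr_ge0 ?sqr_ge0// ltW.
have step k (M : R) : M <= 1 ->
    (forall y, rho x0 y <= r k.+1 -> u y <= M) ->
    forall y, rho x0 y <= r k -> u y <= M * expR (- a k).
  move=> M1 uM y yr; rewrite /a; case: asboolP => [fin|_]; last first.
    by rewrite oppr0 expR0 mulr1 uM// rS (le_trans yr)// ler_peMl ?ler1n ?(ltW (rk0 k)).
  have tr0 : 0 < theta * r k by rewrite mulr_gt0.
  have lnV0 := lnV _ fin; have V2' := V2 _ (r0r k.+1) fin.
  rewrite rS in fin uM lnV0 V2' *.
  have H := subsolution_decay rhoM rc rC th0 thc (ltW C0) thC u0 Lu (rk0 k) (cr k) fin uM.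
  move: H; rewrite -/(V (2 * r k)); set N := (V _)%:R in lnV0 V2' *; set L := ln (2 * N) => H.
  have M0 : 0 <= M by rewrite (le_trans (u0 x1))// uM// -rS.
  have N0 : 0 < N by lra.
  have L0 : 0 < L by rewrite /L ln_gt0//; lra.
  have LN : L <= 2 * ln N.
    by rewrite mulr2n mulrDl mul1r /L lnM ?posrE// lerD2r ler_ln ?posrE.
  have [trL|Ltr] := leP (theta * r k) L.
    apply: le_trans (H y yr) _; rewrite ler_wpM2l// ler_expR lerN2.
    have Zden (Z : R) : 0 < Z -> Z / (8 * (4 * L / Z + 1)) = Z ^+ 2 / (32 * L + 8 * Z).
      by move=> Z0; field; rewrite !gt_eqF// addr_gt0// mulr_gt0.
    rewrite Zden// -exprMn ler_pM2l ?exprn_gt0//.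
    by rewrite lef_pV2 ?posrE ?addr_gt0 ?mulr_gt0//; lra.
  (* Here L / (theta r_k) <= 1, so the denominator in the decay exponent is at most 8 (4 + 1) = 40
     and [u x1] would be smaller than itself. *)
  exfalso; have := H x1 (x1r k); rewrite leNgt => /negP; apply.
  apply: (@le_lt_trans _ _ (expR (- (theta * r k / 40)))); last first.
    by rewrite uD ltr_expR ltrN2.
  rewrite -[leRHS]mul1r ler_pM ?expR_ge0// ler_expR lerN2 ler_pM2l//.
  have q1 : L / (theta * r k) <= 1 by rewrite ler_pdivrMr// mul1r ltW.
  have q0 : 0 < L / (theta * r k) by rewrite divr_gt0.
  by rewrite -[4 * L / _]mulrA lef_pV2 ?posrE; lra.
(* The induction starts from the outermost ball, where only [u <= 1] is known, and adds the decay of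
   one shell at a time inwards. *)
have tele j k y : rho x0 y <= r k -> u y <= expR (- \sum_(0 <= i < j) a (k + i)%N).
  elim: j k y => [|j IH] k y yr; first by rewrite big_nil oppr0 expR0.
  rewrite big_nat_recl// addn0 opprD addrC expRD.
  apply: step yr; first by rewrite -expR0 ler_expR oppr_le0 sumr_ge0.
  move=> z zr; apply: le_trans (IH k.+1 z zr) _; rewrite ler_expR lerN2.
  by rewrite le_eqVlt; apply/orP; left; apply/eqP; apply: eq_bigr => i _; rewrite addSnnS.
have sumaD K : \sum_(0 <= k < K) a k <= D.
  have := tele K 0%N x1 (x1r 0%N); rewrite uD ler_expR lerN2.
  by under eq_bigr do rewrite add0n.
(* The integral is cut at [r0], [r 1], [r 2] and so on. On each piece the integrand is at most the
   right end over the logarithm of the volume at the left end, and it vanishes if that volume is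
   infinite. On the first piece the volume is only known to be at least 2. *)
pose t k := if k is 0%N then r0 else r k.
pose b k := if k is j.+1 then
    (if `[< finite_set (metric_ball rho x0 (r j.+1)) >] then
      r j.+2 / ln (V (r j.+1))%:R else 0)
  else r 1%N / ln 2.
have ln20 : 0 < ln 2 :> R by rewrite ln_gt0// ltr1n.
have b0 k : 0 <= b k.
  case: k => [|k] /=; first by rewrite divr_ge0 ?(ltW ln20) ?(ltW (rk0 _)).
  by case: asboolP => // /lnV V0; rewrite divr_ge0 ?(ltW V0) ?(ltW (rk0 _)).
have tS k : t k <= t k.+1.
  case: k => [|k] /=; first exact: r0r.
  by rewrite (rS k.+1) ler_peMl ?(ltW (rk0 _))// ler1n.
have integrandE s : r0 <= s -> finite_set (metric_ball rho x0 s) ->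
    growth_integrand rho x0 s = (s / ln (V s)%:R)%:E.
  move=> rs fs; have V2s := V2 _ rs fs.
  have V0 : 0 < ln (V s)%:R :> R by rewrite ln_gt0//; lra.
  rewrite /growth_integrand /counting asboolT// lne_EFin; last by rewrite -/(V s); lra.
  by rewrite inver gt_eqF.
have integrandy s : ~ finite_set (metric_ball rho x0 s) ->
    growth_integrand rho x0 s = 0%E.
  by move=> fs; rewrite /growth_integrand /counting asboolF// invey mule0.
have integrand_ge0 s : r0 <= s -> (0 <= growth_integrand rho x0 s)%E.
  move=> rs; have [fs|/integrandy->//] := pselect (finite_set (metric_ball rho x0 s)).
  rewrite integrandE// lee_fin divr_ge0 ?(le_trans r00 rs)// ln_ge0//.
  by have := V2 _ rs fs; lra.
have bound s r' V' : r0 <= s -> s <= r' -> 2 <= V' ->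
    finite_set (metric_ball rho x0 s) -> V' <= (V s)%:R ->
    (growth_integrand rho x0 s <= (r' / ln V')%:E)%E.
  move=> rs sr V'2 fs VV; rewrite integrandE// lee_fin.
  have V'0 : 0 < ln V' by rewrite ln_gt0//; lra.
  apply: ler_pM => //; first exact: le_trans rs.
    by rewrite invr_ge0 ln_ge0//; lra.
  have lnle : ln V' <= ln (V s)%:R by rewrite ler_ln ?posrE; lra.
  by rewrite lef_pV2 ?posrE// (lt_le_trans V'0).
(* The constant is 640 = 8 * 80: since r_(k+2) = 4 r_k and the piece has length 2 r_k, the left-hand
   side is 8 r_k^2 / ln V. *)
have [E E0 bE] : exists2 E : R, 0 < E &
    forall k, b k.+1 * (t k.+2 - t k.+1) <= E * a k.
  exists (640 / theta ^+ 2); first by apply: divr_gt0; rewrite ?ltr0n ?exprn_gt0.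
  move=> k; rewrite /b /t /a; case: asboolP => [/lnV V0|_]; last by rewrite mul0r mulr0.
  rewrite le_eqVlt; apply/orP; left; apply/eqP.
  rewrite !rS.
  have : theta != 0 by rewrite gt_eqF.
  have : ln (V (2 * r k))%:R != 0 :> R by rewrite gt_eqF// -rS.
  by move=> *; field; do ?[apply/andP; split].
have : (\int[lebesgue_measure]_(s in `[r0, +oo[) growth_integrand rho x0 s
    <= (b 0%N * (t 1%N - t 0%N) + E * D)%:E)%E.
  apply: (@integral_le_step _ _ _ t b) => //.
  - move=> s; exists (Num.bound `|s|).+1; apply: (le_lt_trans (ler_norm s)).
    apply: (lt_le_trans (archi_boundP (normr_ge0 s))).
    have R01 : 1 <= R0 by rewrite /R0; lra.
    move: (Num.bound `|s|) => N; rewrite /t /r -natrX.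
    have : N%:R <= (2 ^ N.+1)%:R :> R.
      by rewrite ler_nat ltnW// (ltn_trans (ltnSn N))// ltn_expl.
    by move=> /le_trans; apply; rewrite ler_peMl.
  - move=> k s /andP[ks sk].
    have rs : r0 <= s by case: k ks {sk} => [//|k] /(le_trans (r0r _)).
    rewrite integrand_ge0//=.
    have [fs|/integrandy->] := pselect (finite_set (metric_ball rho x0 s)); last by rewrite lee_fin.
    case: k ks sk => [|k] /= ks sk.
      by apply: bound => //; [exact: ltW|exact: V2].
    have [fk Vk] := VS _ _ ks fs.
    rewrite asboolT//; apply: bound => //; [exact: ltW|exact: V2|by rewrite ler_nat].
  - move=> [|K].
      rewrite big_nil addr_ge0//; last by rewrite mulr_ge0// ltW.
      by rewrite mulr_ge0// subr_ge0; exact: (tS 0%N).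
    rewrite big_nat_recl// lerD2l.
    apply: (@le_trans _ _ (E * \sum_(0 <= k < K) a k)); last by rewrite ler_pM2l.
    by rewrite mulr_sumr; apply: ler_sum => k _; exact: bE.
by rewrite div leye_eq.
Qed.

(** * Laplace transform of the explosion time *)

(* [kill s] is [expR (- s)] for finite [s > 0], written as an average over the
   value [r] of an independent exponential clock, so that integrals of
   [kill (S w)] only involve the tails of [S]. *)
Definition kill (R : realType) (s : \bar R) : \bar R :=
  \int[lebesgue_measure]_r ((exponential_pdf 1 r)%:E *
    (\1_[set p : \bar R * R | (0 < p.1 <= p.2%:E)%E] (s, r))%:E)%E.

Section kill.
Context {R : realType}.
Local Open Scope ereal_scope.

Let clock : set (\bar R * R) := [set p | 0 < p.1 <= p.2%:E].

Lemma measurable_clock : measurable clock.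
Proof.
rewrite (_ : clock = [set p | 0 < p.1] `&` [set p | p.1 <= p.2%:E]); last first.
  by apply/seteqP; split => p /= => [/andP[]|[p1 p2]] //; apply/andP.
apply: measurableI; rewrite -[X in measurable X]setTI.
  exact: (measurable_lte measurableT (measurable_cst _) measurable_fst).
apply: (measurable_lee measurableT measurable_fst).
by apply/measurable_EFinP; exact: measurable_snd.
Qed.

Let density (p : \bar R * R) : \bar R :=
  (exponential_pdf 1 p.2)%:E * (\1_clock p)%:E.

Let measurable_density : measurable_fun setT density.
Proof.
apply: emeasurable_funM; apply/measurable_EFinP.
  apply: measurableT_comp; last exact: measurable_snd.
  exact: measurable_exponential_pdf.
by apply: measurable_indic; exact: measurable_clock.
Qed.

Let density_ge0 p : 0 <= density p.
Proof. by rewrite mule_ge0 ?lee_fin// exponential_pdf_ge0. Qed.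

Lemma kill_ge0 (s : \bar R) : 0 <= kill s.
Proof. by apply: integral_ge0 => r _; exact: (density_ge0 (s, r)). Qed.

Lemma measurable_kill : measurable_fun setT (@kill R).
Proof.
exact: (measurable_fun_fubini_tonelli_F (m2 := @lebesgue_measure R) density).
Qed.

(** The clock rings in [[0, s]] with probability [1 - expR (- s)], and [kill s] has at least the
    remaining mass. *)
Lemma expRN_le_kill (s : R) : (0 < s)%R -> (expR (- s))%:E <= kill s%:E.
Proof.
move=> s0.
have m1 : measurable_fun [set: R] (EFin \o exponential_pdf (1 : R)).
  by apply/measurable_EFinP; exact: measurable_exponential_pdf.
have g0 r : (0 : \bar R) <= (EFin \o exponential_pdf (1 : R)) r.
  by rewrite lee_fin exponential_pdf_ge0.
have : 1 <= (1 - expR (- s))%:E + kill s%:E.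
  rewrite -[leLHS](@integral_exponential_pdf R 1)//.
  have := @exponential_prob_itv0c R 1 s s0; rewrite /exponential_prob mulN1r => H.
  rewrite EFinB -H {H}.
  rewrite [X in _ <= X + _]integral_mkcond /kill -ge0_integralD//; last 4 first.
  - by move=> r _; apply: erestrict_ge0 => x _; exact: g0.
  - exact/(measurable_restrictT _ _).1/measurable_funTS.
  - by move=> r _; exact: (density_ge0 (s%:E, r)).
  - exact: (measurableT_comp measurable_density (pair1_measurable s%:E)).
  apply: le_integral_ge0 => r _; first exact: g0.
  rewrite patchE; case: ifPn => [_|]; first by rewrite leeDl ?(density_ge0 (s%:E, r)).
    rewrite notin_setE/= in_itv/= => /negP; rewrite negb_and -!ltNge => rs.
    have [r0|r0] := ltP r 0%R; first by rewrite /= lt0_exponential_pdf// mul0e adde0.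
    move: rs; rewrite ltNge r0/= => sr.
    by rewrite add0e indicE mem_set ?mule1//= lee_fin lte_fin s0 ltW.
have := kill_ge0 s%:E; case: (kill s%:E) => [k _| _ _|//]; last exact: leey.
by rewrite -EFinD !lee_fin; lra.
Qed.



(** Density of the clock at [r], times the probability that an exponential variable of parameter [a]
    is at most [r]. *)
Let pdf_tail (a r : R) : \bar R :=
  (exponential_pdf 1 r)%:E * (1 - expR (- (a * r)))%:E * (0 <= r)%R%:R%:E.

Let pdf_tail_ge0 (a r : R) : (0 <= a)%R -> 0 <= pdf_tail a r.
Proof.
move=> a0; rewrite /pdf_tail -!EFinM lee_fin.
have [r0|r0] := leP 0%R r; last by rewrite mulr0.
rewrite mulr1 mulr_ge0 ?exponential_pdf_ge0// subr_ge0 -expR0 ler_expR oppr_le0.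
by rewrite mulr_ge0.
Qed.

(** The clock density times an exponential tail is a multiple of the exponential density of
    parameter [1 + a], so the integral of [pdf_tail] follows from total masses, without a
    primitive. *)
Let pdf_tailE (a r : R) : (0 <= a)%R ->
  pdf_tail a r + (1 + a)^-1%:E * (exponential_pdf (1 + a) r)%:E = (exponential_pdf 1 r)%:E.
Proof.
move=> a0; have a1 : (0 < 1 + a)%R by rewrite ltr_pwDl.
rewrite /pdf_tail -!EFinM -EFinD; congr EFin.
have [r0|r0] := leP 0%R r; last by rewrite !lt0_exponential_pdf// !mulr0 addr0.
rewrite !exponential_pdfE// mulr1 mul1r mulrA mulVf ?gt_eqF// mul1r.
by rewrite mulrBr mulr1 -expRD mulNr mul1r mulNr mulrDl mul1r opprD subrK.
Qed.

Let measurable_pdf (b : R) :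
  measurable_fun [set: measurableTypeR R] (fun r => (exponential_pdf b r)%:E).
Proof. by apply/measurable_EFinP; exact: measurable_exponential_pdf. Qed.

Let measurable_pdf_tail (a : R) : (0 <= a)%R ->
  measurable_fun [set: measurableTypeR R] (pdf_tail a).
Proof.
move=> a0; rewrite (_ : pdf_tail a = fun r => (exponential_pdf 1 r)%:E -
    (1 + a)^-1%:E * (exponential_pdf (1 + a) r)%:E); last first.
  by apply/funext => r; rewrite -(pdf_tailE r a0) addeK.
apply: emeasurable_funB; first exact: (measurable_pdf 1%R).
exact: (measurable_funeM _ (measurable_pdf (1 + a)%R)).
Qed.

Let integral_pdf_tail (a : R) : (0 <= a)%R ->
  \int[lebesgue_measure]_r pdf_tail a r = (a / (1 + a))%:E.
Proof.
move=> a0; have a1 : (0 < 1 + a)%R by rewrite ltr_pwDl.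
set F := pdf_tail a.
have F0 r : 0 <= F r by exact: pdf_tail_ge0.
have FE r := pdf_tailE r a0.
have mF := measurable_pdf_tail a0.
have mpdf := measurable_pdf.
have : \int[lebesgue_measure]_r F r + (1 + a)^-1%:E = 1.
  rewrite -[RHS](@integral_exponential_pdf R 1)//.
  rewrite -[X in _ + X]mule1 -(@integral_exponential_pdf R (1 + a))//.
  rewrite -ge0_integralZl ?lee_fin ?invr_ge0 ?ltW//; last first.
    by move=> r _; rewrite lee_fin exponential_pdf_ge0// ltW.
  rewrite -ge0_integralD//; last 2 first.
  - move=> r _; rewrite -EFinM lee_fin mulr_ge0 ?exponential_pdf_ge0// ?invr_ge0 ltW//.
  - exact: (measurable_funeM _ (mpdf (1 + a)%R)).
  by apply: eq_integral => r _; rewrite FE.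
have : 0 <= \int[lebesgue_measure]_r F r by exact: integral_ge0.
case: (\int[lebesgue_measure]_r F r) => [z _ [zE]| |]//.
congr EFin; apply: (addIr ((1 + a)^-1)%R).
by rewrite zE -[X in (_ + X)%R]mul1r -mulrDl (addrC a) divff// gt_eqF.
Qed.

(** An exponential variable of parameter [a] has Laplace transform [a / (1 + a)] at 1. By Tonelli
    the clock is integrated last. The weight [W] carries along the path and the other holding times,
    in place of a conditioning. *)
Lemma integral_kill d (Omega : measurableType d) (P : probability Omega R)
    (W S : Omega -> \bar R) (c a : R) :
  measurable_fun setT W -> (forall w, 0 <= W w) -> measurable_fun setT S ->
  (0 <= c)%R -> (0 <= a)%R ->
  (forall t : R, (0 <= t)%R ->
    \int[P]_w (W w * (\1_[set v : Omega | (t%:E < S v)%E] w)%:E) = (c * expR (- (a * t)))%:E) ->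
  \int[P]_w (W w * kill (S w)) = (c * (a / (1 + a)))%:E.
Proof.
move=> mW W0 mS c0 a0 tail.
pose f (p : Omega * R) : \bar R := W p.1 * density (S p.1, p.2).
have mdS : measurable_fun [set: Omega * R] (fun p => density (S p.1, p.2)).
  apply: (measurableT_comp measurable_density).
  apply/measurable_fun_pairP; split => /=; last exact: measurable_snd.
  exact: (measurableT_comp mS measurable_fst).
have mf : measurable_fun setT f.
  by apply: emeasurable_funM => //; exact: (measurableT_comp mW measurable_fst).
have f0 p : 0 <= f p by rewrite mule_ge0.
transitivity (\int[P]_w \int[@lebesgue_measure R]_r f (w, r)).
  apply: eq_integral => w _; rewrite /f /= ge0_integralZl//.
  exact: (measurableT_comp measurable_density (pair1_measurable (S w))).
transitivity (\int[@lebesgue_measure R]_r \int[P]_w f (w, r)).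
  exact: (@fubini_tonelli _ _ Omega (measurableTypeR R) R P (@lebesgue_measure R)).
have mWS (B : set Omega) : measurable B ->
    measurable_fun setT (fun w => W w * (\1_B w)%:E).
  by move=> mB; apply: emeasurable_funM => //; exact/measurable_EFinP/measurable_indic.
have WS0 (B : set Omega) w : 0 <= W w * (\1_B w)%:E by rewrite mule_ge0 ?lee_fin.
have mS_gt (t : R) : measurable [set w | t%:E < S w].
  by rewrite -[X in measurable X]setTI; exact: (measurable_lte measurableT (measurable_cst _) mS).
have mA (r : R) : measurable [set w | 0 < S w <= r%:E].
  rewrite (_ : [set w | _] = [set w | 0 < S w] `&` [set w | S w <= r%:E]); last first.
    by apply/seteqP; split => w /= => [/andP[]|[w1 w2]] //; apply/andP.
  apply: measurableI; first exact: (mS_gt 0%R).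
  by rewrite -[X in measurable X]setTI; exact: (measurable_lee measurableT mS (measurable_cst _)).
have indE (b : Omega -> bool) w : \1_[set v | b v] w = (b w)%:R%R :> R.
  by rewrite indicE; congr (nat_of_bool _)%:R%R; apply/idP/idP; rewrite inE.
(* Difference of the tails at 0 and at [r], in accordance with the strict inequality [0 < p.1] in
   [kill]. *)
have intA (r : R) : (0 <= r)%R ->
    \int[P]_w (W w * (\1_[set v : Omega | (0 < S v <= r%:E)%E] w)%:E) = (c * (1 - expR (- (a * r))))%:E.
  move=> r0; have := tail 0%R (lexx _); rewrite mulr0 oppr0 expR0 mulr1.
  rewrite (eq_integral (fun w => W w * (\1_[set v : Omega | (0 < S v <= r%:E)%E] w)%:E +
      W w * (\1_[set v : Omega | (r%:E < S v)%E] w)%:E)); last first.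
    move=> w _; rewrite -ge0_muleDr ?lee_fin// -EFinD; congr (_ * _%:E).
    rewrite !indE; have [Sr|Sr] := leP (S w) r%:E.
      by rewrite andbT addr0.
    by rewrite andbF add0r (le_lt_trans _ Sr)// lee_fin.
  rewrite ge0_integralD//; [|exact: mWS|exact: mWS]; rewrite tail//.
  have : 0 <= \int[P]_w (W w * (\1_[set v : Omega | (0 < S v <= r%:E)%E] w)%:E) by exact: integral_ge0.
  case: (\int[P]_w _) => [z _ [zE]| |]//; congr EFin; lra.
rewrite EFinM -integral_pdf_tail// -ge0_integralZl//; last 2 first.
- exact: measurable_pdf_tail.
- by move=> r _; exact: pdf_tail_ge0.
apply: eq_integral => r _; rewrite /f /density /pdf_tail /=.
have [r0|r0] := leP 0%R r; last first.
  rewrite lt0_exponential_pdf// !mul0e mule0.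
  by apply: integral0_eq => w _; rewrite mul0e mule0.
rewrite mule1 muleCA -(EFinM c) -intA// -ge0_integralZl//; last 2 first.
- exact: mWS.
- by rewrite lee_fin exponential_pdf_ge0.
by apply: eq_integral => w _; rewrite muleCA.
Qed.

End kill.

Section iterated_kill.
Context {R : realType} d (Omega : measurableType d) (P : probability Omega R).
Variables (S : nat -> Omega -> \bar R) (a : nat -> R).
Hypotheses (mS : forall i, measurable_fun setT (S i)) (a0 : forall i, 0 <= a i).
Local Open Scope ereal_scope.

Lemma measurable_prod_kill (n : nat) :
  measurable_fun setT (fun w => \prod_(0 <= i < n) kill (S i w)).
Proof.
elim: n => [|n IH].
  by rewrite (_ : (fun w => _) = cst 1)//; apply/funext => w; rewrite big_geq.
rewrite (_ : (fun w => _) = (fun w => (\prod_(0 <= i < n) kill (S i w)) * kill (S n w))).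
  by apply: emeasurable_funM => //; exact: (measurableT_comp measurable_kill (mS n)).
by apply/funext => w; rewrite big_nat_recr.
Qed.

(** Tail indicators are traded for factors [kill] one index at a time, from the last. With the other
    times fixed, the hypothesis is an exponential tail in one variable; the factor obtained then
    joins [W]. *)
Lemma integral_prod_kill (n : nat) (W : Omega -> \bar R) (c : R) :
  measurable_fun setT W -> (forall w, 0 <= W w) -> (0 <= c)%R ->
  (forall t : nat -> R, (forall i, (0 <= t i)%R) ->
    \int[P]_w (W w * \prod_(0 <= i < n)
      (\1_[set v : Omega | ((t i)%:E < S i v)%E] w)%:E) =
    (c * \prod_(0 <= i < n) expR (- (a i * t i)))%:E) ->
  \int[P]_w (W w * \prod_(0 <= i < n) kill (S i w)) =
  (c * \prod_(0 <= i < n) (a i / (1 + a i)))%:E.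
Proof.
have m1 (t : R) i : measurable_fun setT
    (fun w => (\1_[set v : Omega | (t%:E < S i v)%E] w)%:E : \bar R).
  apply/measurable_EFinP/measurable_indic; rewrite -[X in measurable X]setTI.
  exact: (measurable_lte measurableT (measurable_cst _) (mS i)).
have mprod (t : nat -> R) n' : measurable_fun setT
    (fun w => \prod_(0 <= i < n') (\1_[set v : Omega | ((t i)%:E < S i v)%E] w)%:E : \bar R).
  elim: n' => [|m IH].
    by rewrite (_ : (fun w => _) = cst 1)//; apply/funext => w; rewrite big_geq.
  rewrite (_ : (fun w => _) = (fun w => (\prod_(0 <= i < m)
    (\1_[set v : Omega | ((t i)%:E < S i v)%E] w)%:E) * (\1_[set v : Omega | ((t m)%:E < S m v)%E] w)%:E)).
    by apply: emeasurable_funM.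
  by apply/funext => w; rewrite big_nat_recr.
have prod0 (t : nat -> R) n' w :
    0 <= \prod_(0 <= i < n') (\1_[set v : Omega | ((t i)%:E < S i v)%E] w)%:E :> \bar R.
  by apply: prode_ge0 => i; rewrite lee_fin.
elim: n W c => [|n IH] W c mW W0 c0 tail.
  have := tail (fun=> 0%R) (fun=> lexx _); rewrite !big_geq// => <-.
  by apply: eq_integral => w _; rewrite !big_geq.
have -> : \int[P]_w (W w * \prod_(0 <= i < n.+1) kill (S i w)) =
    \int[P]_w ((W w * kill (S n w)) * \prod_(0 <= i < n) kill (S i w)).
  by apply: eq_integral => w _; rewrite big_nat_recr// muleA muleAC.
rewrite big_nat_recr//= mulrA mulrAC.
apply: (IH (fun w => W w * kill (S n w)) (c * (a n / (1 + a n)))%R).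
- by apply: emeasurable_funM => //; exact: (measurableT_comp measurable_kill (mS n)).
- by move=> w; rewrite mule_ge0// kill_ge0.
- by rewrite mulr_ge0// divr_ge0// addr_ge0.
move=> t t0.
transitivity (\int[P]_w ((W w * \prod_(0 <= i < n)
    (\1_[set v : Omega | ((t i)%:E < S i v)%E] w)%:E) * kill (S n w))).
  by apply: eq_integral => w _; rewrite muleAC.
rewrite (@integral_kill _ _ _ P _ _ (c * \prod_(0 <= i < n) expR (- (a i * t i)))%R (a n))//.
- by rewrite mulrAC.
- exact: emeasurable_funM.
- by move=> w; rewrite mule_ge0.
- by rewrite mulr_ge0// prodr_ge0// => i _; rewrite expR_ge0.
move=> s s0.
have := tail (fun i => if (i < n)%N then t i else s).
rewrite big_nat_recr//= ltnn -mulrA.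
have -> : (\prod_(0 <= i < n) expR (- (a i * (if (i < n)%N then t i else s))) =
    \prod_(0 <= i < n) expR (- (a i * t i)))%R.
  by rewrite big_nat [RHS]big_nat; apply: eq_bigr => i /andP[_ ->].
move=> <-; last by move=> i; case: ifP.
apply: eq_integral => w _; rewrite big_nat_recr//= ltnn muleA; congr (_ * _ * _).
by rewrite big_nat [RHS]big_nat; apply: eq_bigr => i /andP[_ ->].
Qed.

End iterated_kill.

(** * Jump chain along finite paths *)

Section paths.
Context {R : realType} (Gamma : weighted_graph R).
Implicit Types (x y z : Gamma) (phi : Gamma -> R).

Definition nbrs x : seq Gamma := enum_fset (fset_set (neighbors x)).

Lemma mem_nbrs x y : (y \in nbrs x) = edge x y.
Proof.
rewrite /nbrs in_fset_set; last exact: edge_locally_finite.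
by apply/idP/idP; rewrite inE.
Qed.

Lemma uniq_nbrs x : uniq (x :: nbrs x).
Proof. by rewrite /= mem_nbrs edge_irr fset_uniq. Qed.

Lemma sum_nbrs x phi :
  \sum_(y \in neighbors x) weight x y * phi y = \sum_(y <- nbrs x) weight x y * phi y.
Proof. by apply: sum_neighbors => [|y]; rewrite ?fset_uniq ?mem_nbrs. Qed.

Lemma vertex_weightE x : vertex_weight x = \sum_(y <- nbrs x) weight x y.
Proof.
rewrite /vertex_weight; have := sum_nbrs x (fun=> 1).
under eq_fsbigr do rewrite mulr1.
by move=> ->; apply: eq_bigr => y _; rewrite mulr1.
Qed.

Lemma vertex_weight_ge0 x : 0 <= vertex_weight x.
Proof. by rewrite vertex_weightE sumr_ge0// => y _; exact: weight_ge0. Qed.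

Lemma jump_prob_ge0 x y : 0 <= jump_prob x y.
Proof.
rewrite /jump_prob; case: ifP => _ //.
by rewrite divr_ge0 ?weight_ge0 ?vertex_weight_ge0.
Qed.

Lemma sum_jump_prob x : \sum_(y <- x :: nbrs x) jump_prob x y = 1.
Proof.
rewrite big_cons /jump_prob; case: eqVneq => [_|px].
  rewrite eqxx big_seq big1 ?addr0// => y; rewrite mem_nbrs.
  by case: eqVneq => // <-; rewrite edge_irr.
by rewrite weight_eq0 ?edge_irr// mul0r add0r -mulr_suml -vertex_weightE divff.
Qed.

(* A path with [n] steps is coded as a function constant after [n]. Staying put
   is an allowed step because [jump_prob] makes isolated vertices do so. *)
Fixpoint paths (n : nat) x : seq (nat -> Gamma) :=
  if n is m.+1 then
    [seq (fun i => if i is j.+1 then p j else x) | z <- x :: nbrs x, p <- paths m z]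
  else [:: fun=> x].

Lemma pathsS n x : paths n.+1 x =
  [seq (fun i => if i is j.+1 then p j else x) | z <- x :: nbrs x, p <- paths n z].
Proof. by []. Qed.

Lemma paths0 n x p : p \in paths n x -> p 0%N = x.
Proof.
case: n => [|n]; first by rewrite inE => /eqP->.
by move=> /allpairsPdep[z [q [_ _ ->]]].
Qed.

Lemma paths_inj n x p q : p \in paths n x -> q \in paths n x ->
  (forall i, (i <= n)%N -> p i = q i) -> p = q.
Proof.
elim: n x p q => [|n IH] x p q.
  have h r : r \in paths 0 x -> r = (fun=> x) by rewrite inE => /eqP.
  by move=> /h-> /h->.
move=> /allpairsPdep[z [p' [_ p'P ->]]] /allpairsPdep[z' [q' [_ q'P ->]]] pq.
have zz : z = z' by rewrite -(paths0 p'P) -(paths0 q'P); exact: (pq 1%N).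
rewrite -zz in q'P; rewrite (IH z p' q')// => i ni; exact: (pq i.+1).
Qed.

Lemma uniq_paths n x : uniq (paths n x).
Proof.
elim: n x => [//|n IH] x; apply: allpairs_uniq_dep.
- exact: uniq_nbrs.
- by move=> z _; exact: IH.
move=> [z p] [z' p'] /allpairsPdep[z1 [p1 [_ h1 [-> e1]]]].
move=> /allpairsPdep[z2 [p2 [_ h2 [-> e2]]]] /= e.
have pp : p1 = p2.
  by apply/funext => i; have := congr1 (fun f => f i.+1) e; rewrite /= e1 e2.
have zz : z1 = z2 by rewrite -(paths0 h1) pp (paths0 h2).
by rewrite e1 e2 pp zz.
Qed.

(** E^x[phi (Y 0) ... phi (Y n)] for the jump chain [Y], by conditioning on the first jump. *)
Fixpoint path_mean phi n x : R :=
  if n is m.+1 then phi x * \sum_(z <- x :: nbrs x) jump_prob x z * path_mean phi m z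
  else phi x.

Lemma sum_paths phi n x :
  \sum_(p <- paths n x) (\prod_(0 <= i < n) jump_prob (p i) (p i.+1)) *
    \prod_(0 <= i < n.+1) phi (p i) = path_mean phi n x.
Proof.
elim: n x => [|n IH] x; first by rewrite /= big_seq1 big_geq// mul1r big_nat1.
rewrite pathsS big_allpairs_dep [RHS]/= mulr_sumr; apply: eq_bigr => z _.
rewrite -IH !mulr_sumr big_seq [RHS]big_seq; apply: eq_bigr => p pz.
by rewrite big_nat_recl// big_nat_recl//= (paths0 pz); ring.
Qed.

Lemma path_mean1 n x : path_mean (fun=> 1) n x = 1.
Proof.
elim: n x => [//|n IH] x /=; rewrite mul1r -[RHS](sum_jump_prob x).
by apply: eq_bigr => z _; rewrite IH mulr1.
Qed.

(* [survival n x] is E^x[exp (- (S 0 + ... + S (n - 1)))]. *)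
Fixpoint survival n x : R :=
  if n is m.+1 then
    (\sum_(y \in neighbors x) weight x y * survival m y) / (1 + vertex_weight x)
  else 1.

(** At a vertex of weight a > 0, the Laplace transform a / (1 + a) of the holding time meets the
    jump probability [weight / a]; a cancels and the recursion of [survival] appears. *)
Lemma path_mean_survival n x :
  path_mean (fun z => vertex_weight z / (1 + vertex_weight z)) n x = survival n.+1 x.
Proof.
elim: n x => [|n IH] x.
  rewrite /= vertex_weightE; congr (_ / _).
  by rewrite sum_nbrs; apply: eq_bigr => y _; rewrite mulr1.
rewrite [LHS]/=; under eq_bigr do rewrite IH.
rewrite -[RHS]/((\sum_(y \in neighbors x) weight x y * survival n.+1 y) /
  (1 + vertex_weight x)).
have den : 1 + vertex_weight x != 0.
  by rewrite gt_eqF// ltr_pwDl// vertex_weight_ge0.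
(* An isolated vertex is never left: its factor a / (1 + a) is 0 on the left, and all its weights
   are 0 on the right. *)
have [px|px] := eqVneq (vertex_weight x) 0.
  rewrite px mul0r mul0r sum_nbrs big_seq big1 ?mul0r// => y yx.
  suff -> : weight x y = 0 by rewrite mul0r.
  have := px; rewrite vertex_weightE => /eqP.
  rewrite psumr_eq0; last by move=> *; exact: weight_ge0.
  by move=> /allP/(_ _ yx)/eqP.
rewrite sum_nbrs big_cons {1}/jump_prob (negbTE px) weight_eq0 ?edge_irr//.
rewrite !mul0r add0r mulrAC; congr (_ / _).
rewrite mulr_sumr; apply: eq_bigr => y _; rewrite /jump_prob (negbTE px).
by move: (survival n.+1 y) => s; field.
Qed.

End paths.

(** Positivity matters because [kill] is 0 at 0. Each [s i] is finite because the sum is. *)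
Lemma expRN_le_prod_kill (R : realType) (s : nat -> \bar R) (n : nat) (t : R) :
  (forall i, (i < n)%N -> 0 < s i)%E -> (\sum_(0 <= i < n) s i <= t%:E)%E ->
  ((expR (- t))%:E <= \prod_(0 <= i < n) kill (s i))%E.
Proof.
elim: n t => [|n IH] t s0; first by rewrite !big_geq// !lee_fin -expR0 ler_expR oppr_le0.
rewrite !big_nat_recr//=.
have sum0 : (0 <= \sum_(0 <= i < n) s i)%E.
  by rewrite big_nat sume_ge0// => i /andP[_ ni]; rewrite ltW// s0// ltnW.
have sn0 := s0 n (ltnSn n).
case sn: (s n) sn0 => [r|//|//] r0 sumt; last first.
  by move: sumt; rewrite addey ?leye_eq// gt_eqF// (lt_le_trans _ sum0)// ltNyr.
have sum' : (\sum_(0 <= i < n) s i <= (t - r)%:E)%E by rewrite EFinB leeBrDr.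
have -> : expR (- t) = expR (- (t - r)) * expR (- r) by rewrite -expRD; congr expR; ring.
rewrite EFinM lee_pmul ?lee_fin ?expR_ge0//; last exact: expRN_le_kill.
by apply: IH => // i ni; apply: s0; exact: ltnW.
Qed.

Lemma mul_prod_indic (R : realType) (T : Type) (A : set T) (B : nat -> set T)
    (n : nat) (w : T) :
  ((\1_A w)%:E * \prod_(0 <= i < n) (\1_(B i) w)%:E)%E =
  (\1_[set v | A v /\ forall i, (i < n)%N -> B i v] w)%:E :> \bar R.
Proof.
elim: n => [|n IH].
  by rewrite big_geq// mule1; congr (\1_ _ w)%:E; apply/seteqP; split => v //= [].
have indM (C D : set T) : \1_C w * \1_D w = \1_(C `&` D) w :> R by rewrite indicI.
rewrite big_nat_recr//= muleA IH -EFinM indM; congr (\1_ _ w)%:E.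
apply/seteqP; split => v /= [].
  move=> [Av Bv] Bn; split => // i; rewrite ltnS leq_eqVlt => /predU1P[->//|]; exact: Bv.
move=> Av Bv; split; last exact: Bv.
by split=> // i ni; apply: Bv; exact: ltnW.
Qed.

(** * Explosion of the walk controlled by [survival] *)

Section walk.
Context {R : realType} (Gamma : weighted_graph R) (x : Gamma).
Context d (Omega : measurableType d) (P : probability Omega R).
Variables (Y : nat -> Omega -> Gamma) (S : nat -> Omega -> \bar R).
Hypothesis walk : is_vsrw x P Y S.

(** Laplace transform at 1 of the holding time at [z], not its exponential parameter. *)
Let rate (z : Gamma) : R := vertex_weight z / (1 + vertex_weight z).

Let mS n : measurable_fun setT (S n). Proof. exact: vsrw_measurable_time walk n. Qed.

Let measurable_forall (A : nat -> set Omega) (n : nat) :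
  (forall i, measurable (A i)) -> measurable [set w | forall i, (i < n)%N -> A i w].
Proof.
move=> mA.
rewrite (_ : [set w | _] = \bigcap_i (if (i < n)%N then A i else setT)).
  by apply: bigcapT_measurable => i; case: ifP.
apply/seteqP; split => w /= Aw i; first by move=> _; case: ifP => // /Aw.
by move=> ni; have := Aw i Logic.I; rewrite ni.
Qed.

Let measurable_gt (t : R) i : measurable [set w | (t%:E < S i w)%E].
Proof.
rewrite -[X in measurable X]setTI.
exact: (measurable_lte measurableT (measurable_cst _) (mS i)).
Qed.

Let site (n : nat) (y : nat -> Gamma) : set Omega :=
  [set w | forall i, (i < n)%N -> Y i w = y i].

Let measurable_site n y : measurable (site n y).
Proof. by apply: measurable_forall => i; exact: vsrw_measurable_site walk i (y i). Qed.

Let jumps (n : nat) (y : nat -> Gamma) : R :=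
  (y 0%N == x)%:R * \prod_(0 <= i < n) jump_prob (y i) (y i.+1).

Let jumps_ge0 n y : 0 <= jumps n y.
Proof. by rewrite mulr_ge0// prodr_ge0// => i _; exact: jump_prob_ge0. Qed.

Lemma integral_site_kill n y :
  (\int[P]_w ((\1_(site n.+1 y) w)%:E * \prod_(0 <= i < n.+1) kill (S i w)) =
  (jumps n y * \prod_(0 <= i < n.+1) rate (y i))%:E)%E.
Proof.
have y0 i : 0 <= vertex_weight (y i) by exact: vertex_weight_ge0.
apply: (@integral_prod_kill _ _ _ P S _ mS y0 n.+1
  (fun w => (\1_(site n.+1 y) w)%:E) (jumps n y)) => //.
  exact/measurable_EFinP/measurable_indic.
move=> t t0; rewrite -(vsrw_law walk n y t0).
have mE : measurable [set w | site n.+1 y w /\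
    forall i, (i < n.+1)%N -> ((t i)%:E < S i w)%E].
  apply: measurableI; first exact: measurable_site.
  by apply: measurable_forall => i; exact: measurable_gt.
under eq_integral do rewrite mul_prod_indic.
rewrite integral_indic// setIT; congr (P _); apply/seteqP; split => w /=.
  by move=> [Yw Sw] i ni; split; [exact: Yw|exact: Sw].
by move=> YS; split => i /YS[].
Qed.

(** Positive holding times are included so that [expRN_le_prod_kill] applies on this event. *)
Let visit (n : nat) (y : nat -> Gamma) : set Omega :=
  [set w | forall i, (i <= n)%N -> Y i w = y i /\ (0%:E < S i w)%E].

Let measurable_visit n y : measurable (visit n y).
Proof.
apply: (@measurable_forall
  (fun i => [set w | Y i w = y i] `&` [set w | (0%:E < S i w)%E]) n.+1) => i.
apply: measurableI; last exact: measurable_gt.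
exact: vsrw_measurable_site walk i (y i).
Qed.

Let trivIset_visit n : trivIset [set` paths n x] (visit n).
Proof.
move=> p q /= pP qP [w [/= pw qw]]; apply: (paths_inj pP qP) => i ni.
by rewrite -(pw i ni).1 -(qw i ni).1.
Qed.

(** The law taken at times 0 gives the probabilities of the coded paths, and these sum to 1: up to a
    null set, the first [n] steps follow one of finitely many paths. *)
Let visited n : P (\bigcup_(p in [set` paths n x]) visit n p) = 1%E.
Proof.
rewrite measure_fin_bigcup//; last exact: finite_seq.
rewrite -fsbig_seq ?uniq_paths//.
transitivity (\sum_(p <- paths n x)
    (\prod_(0 <= i < n) jump_prob (p i) (p i.+1) * \prod_(0 <= i < n.+1) 1)%:E)%E.
  rewrite big_seq [RHS]big_seq; apply: eq_bigr => p /paths0 p0.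
  apply: (eq_trans (vsrw_law walk n p (t := fun=> 0) (fun=> lexx _))).
  rewrite p0 eqxx mul1r; congr (_ * _)%:E.
  by apply: eq_bigr => i _; rewrite mulr0 oppr0 expR0.
by rewrite sumEFin (sum_paths (fun=> 1)) path_mean1.
Qed.

Let clock_le (n : nat) (t : R) : set Omega :=
  [set w | (\sum_(0 <= i < n) S i w <= t%:E)%E].

Let measurable_clock_le n t : measurable (clock_le n t).
Proof.
rewrite -[X in measurable X]setTI; apply: measurable_lee => //.
exact: emeasurable_sum.
Qed.

(** Markov's inequality for exp(-(S 0 + ... + S n)), with [kill] in place of the exponentials,
    summed over the finitely many paths of [visited]. *)
Lemma vsrw_clock_le n (t : R) :
  (P (clock_le n.+1 t) <= (expR t * survival n.+1 x)%:E)%E.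
Proof.
set V := \bigcup_(p in [set` paths n x]) visit n p.
have mV : measurable V by apply: fin_bigcup_measurable => //; exact: finite_seq.
have PV : P (~` V) = 0%E by rewrite probability_setC// visited subee.
have -> : P (clock_le n.+1 t) = P (clock_le n.+1 t `&` V).
  apply/eqP; rewrite eq_le; apply/andP; split; last first.
    by apply: le_measure; rewrite ?inE//; exact: measurableI.
  apply: (@le_trans _ _ (P ((clock_le n.+1 t `&` V) `|` ~` V))%E).
    apply: le_measure; rewrite ?inE//.
      by apply: measurableU; [exact: measurableI|exact: measurableC].
    by move=> w cw; have [Vw|] := pselect (V w); [left|right].
  have U2 : (P ((clock_le n.+1 t `&` V) `|` ~` V) <=
      P (clock_le n.+1 t `&` V) + P (~` V))%E.
    by apply: measureU2; [exact: measurableI|exact: measurableC].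
  by apply: (le_trans U2); rewrite PV adde0.
rewrite setI_bigcupr measure_fin_bigcup//; last 3 first.
- exact: finite_seq.
- by apply: trivIset_setIl; exact: trivIset_visit.
- by move=> p _; exact: measurableI.
rewrite -fsbig_seq ?uniq_paths// -path_mean_survival -sum_paths mulr_sumr -sumEFin.
rewrite big_seq [leRHS]big_seq; apply: lee_sum => p /paths0 p0.
have -> : \prod_(0 <= i < n) jump_prob (p i) (p i.+1) = jumps n p.
  by rewrite /jumps p0 eqxx mul1r.
rewrite EFinM -integral_site_kill -ge0_integralZl//; last 2 first.
- apply: emeasurable_funM; first exact/measurable_EFinP/measurable_indic.
  exact: measurable_prod_kill.
- move=> w _; rewrite mule_ge0 ?lee_fin// prode_ge0// => i _; exact: kill_ge0.
have mB : measurable (clock_le n.+1 t `&` visit n p) by exact: measurableI.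
apply: (@le_trans _ _ (\int[P]_w (\1_(clock_le n.+1 t `&` visit n p) w)%:E)%E).
  by rewrite integral_indic// setIT.
apply: le_integral_ge0 => w _; first by rewrite lee_fin.
have K0 : (0 <= \prod_(0 <= i < n.+1) kill (S i w))%E.
  by apply: prode_ge0 => i _; exact: kill_ge0.
rewrite indicE; case: (boolP (w \in _)) => [/set_mem[cw vw]|_]; last first.
  by rewrite !mule_ge0 ?lee_fin ?expR_ge0.
rewrite indicE mem_set ?mul1e; last by move=> i /vw[].
apply: (@le_trans _ _ ((expR t)%:E * (expR (- t))%:E)%E).
  by rewrite -EFinM -expRD subrr expR0.
apply: lee_wpmul2l; first by rewrite lee_fin expR_ge0.
by apply: expRN_le_prod_kill cw => i ni; exact: (vw i ni).2.
Qed.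

Let measurable_clock_lt n t : measurable [set w | (t%:E < \sum_(0 <= i < n) S i w)%E].
Proof.
rewrite -[X in measurable X]setTI; apply: measurable_lte => //.
exact: emeasurable_sum.
Qed.

Let measurable_vsrw_at t y : measurable (vsrw_at Y S t y).
Proof.
rewrite (_ : vsrw_at Y S t y = \bigcup_n ([set w | Y n w = y] `&`
    (clock_le n t `&` [set w | (t%:E < \sum_(0 <= i < n.+1) S i w)%E]))).
  apply: bigcupT_measurable => n; apply: measurableI.
    exact: vsrw_measurable_site walk n y.
  by apply: measurableI.
apply/seteqP; split => w /= => [[n [Yn /andP[St tS]]]|[n _ [Yn [St tS]]]]; exists n => //.
by split => //; apply/andP.
Qed.

(** By [vsrw_clock_le], small values of [survival] mean that almost surely some jump time exceeds
    [t]; the walk is then at exactly one vertex at time [t]. *)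
Lemma esum_vsrw_at (t : R) : 0 <= t ->
  (forall e : R, 0 < e -> exists n, survival n.+1 x <= e) ->
  (\esum_(y in [set: Gamma]) P (vsrw_at Y S t y) = 1)%E.
Proof.
move=> t0 surv0.
have S0 n w : (0 <= S n w)%E by exact: vsrw_time_ge0 walk n w.
have sum_mono n m w : (n <= m)%N -> (\sum_(0 <= i < n) S i w <= \sum_(0 <= i < m) S i w)%E.
  by move=> nm; apply: lee_sum_nneg_natr.
have disj : trivIset setT (vsrw_at Y S t).
  move=> y z _ _ [w [[n [<- /andP[Sn tSn]]] [m [<- /andP[Sm tSm]]]]].
  suff -> : n = m by [].
  apply/eqP; rewrite eqn_leq; apply/andP; split; rewrite leqNgt; apply/negP => nm.
    by have := le_lt_trans Sn (lt_le_trans tSm (sum_mono _ _ w nm)); rewrite ltxx.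
  by have := le_lt_trans Sm (lt_le_trans tSn (sum_mono _ _ w nm)); rewrite ltxx.
pose U := \bigcup_y vsrw_at Y S t y.
(* Encoding vertices by [pickle] turns the union over vertices into one over natural numbers, where
   countable additivity applies. *)
pose F (k : nat) : set Omega := if (choice.pickle_inv k : option Gamma) is Some y
  then vsrw_at Y S t y else set0.
have FE (y : Gamma) : F (choice.pickle y) = vsrw_at Y S t y by rewrite /F choice.pickleK_inv.
pose D := range (@choice.pickle Gamma).
have mF k : measurable (F k) by rewrite /F; case: choice.pickle_inv => [y|].
have UE : U = \bigcup_(k in D) F k.
  apply/seteqP; split => w.
    by move=> [y _ yw]; exists (choice.pickle y); rewrite ?FE//; exists y.
  by move=> [_ [y _ <-]]; rewrite FE => yw; exists y.
have disjF : trivIset D F.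
  move=> _ _ [y _ <-] [z _ <-]; rewrite !FE => yz.
  by rewrite (disj y z).
have mU : measurable U by rewrite UE; apply: bigcup_measurable => k _.
(* If the walk is at no vertex at time [t], no jump time can be the first to exceed [t]; by
   induction none does. *)
have notU n : ~` U `<=` clock_le n t.
  move=> w nUw; elim: n => [|n IH]; first by rewrite /clock_le/= big_geq.
  rewrite /clock_le/= leNgt; apply/negP => tS; apply: nUw; exists (Y n w) => //.
  by exists n; split => //; apply/andP.
have PU : P (~` U) = 0%E.
  apply/eqP; rewrite eq_le measure_ge0 andbT; apply/lee_addgt0Pr => e e0; rewrite add0e.
  have [n sn] := surv0 (e / expR t) (divr_gt0 e0 (expR_gt0 t)).
  apply: (@le_trans _ _ (P (clock_le n.+1 t))).
    by apply: le_measure; rewrite ?inE//; exact: measurableC.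
  apply: (le_trans (vsrw_clock_le n t)); rewrite lee_fin.
  by rewrite -ler_pdivlMl ?expR_gt0// mulrC.
have PU1 : P U = 1%E.
  by have := probability_setC P (measurableC mU); rewrite setCK PU sube0.
rewrite -PU1; transitivity (\esum_(k in D) P (F k))%E.
  rewrite (reindex_esum [set: Gamma] _ choice.pickle)//; last first.
    by apply/inj_bij => y z _ _; exact: (pcan_inj choice.pickleK_inv).
  by apply: eq_esum => y _; rewrite FE.
rewrite UE measure_bigcup// nneseries_esum//; congr esum.
by apply/seteqP; split => k /=; rewrite inE.
Qed.

End walk.

(** * Limit of the survival functions *)

Section survival.
Context {R : realType} (Gamma : weighted_graph R).
Implicit Types x : Gamma.

Let den_gt0 x : 0 < 1 + vertex_weight x.
Proof. by rewrite ltr_pwDl// vertex_weight_ge0. Qed.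

Lemma survivalS n x : survival n.+1 x * (1 + vertex_weight x) =
  \sum_(y <- nbrs x) weight x y * survival n y.
Proof. by rewrite /= divfK ?gt_eqF// sum_nbrs. Qed.

Lemma survival_ge0 n x : 0 <= survival n x.
Proof.
elim: n x => [//|n IH] x; rewrite -(pmulr_lge0 _ (den_gt0 x)) survivalS.
by rewrite sumr_ge0// => y _; rewrite mulr_ge0 ?weight_ge0.
Qed.

Lemma survival_le n x : survival n.+1 x <= survival n x.
Proof.
elim: n x => [|n IH] x; rewrite -(ler_pM2r (den_gt0 x)).
  rewrite survivalS; under eq_bigr do rewrite mulr1.
  by rewrite -vertex_weightE mul1r lerDr.
rewrite !survivalS; apply: ler_sum => y _.
by rewrite ler_wpM2l ?weight_ge0.
Qed.

Lemma survival_le1 n x : survival n x <= 1.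
Proof. by elim: n x => [//|n IH] x; rewrite (le_trans (survival_le n x)). Qed.

(** The decreasing limit [u] stays between 0 and 1. Passing to the limit in [survivalS], a finite
    sum by local finiteness, gives [u <= L u], so the Liouville property forces [u] to vanish. *)
Lemma survival_cvg0 :
  (forall u : Gamma -> R, (forall x, 0 <= u x <= 1) ->
    (forall x, u x <= \sum_(y \in neighbors x) weight x y * (u y - u x)) ->
    forall x, u x = 0) ->
  forall x, survival n x @[n --> \oo] --> (0 : R).
Proof.
move=> liouville x.
have mono (y : Gamma) : nonincreasing_seq (fun n => survival n y).
  by apply/nonincreasing_seqP => n; exact: survival_le.
have cv (y : Gamma) : cvgn (fun n => survival n y).
  apply: nonincreasing_is_cvgn; first exact: mono.
  by exists 0 => _ [n _ <-]; exact: survival_ge0.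
pose u (y : Gamma) := limn (fun n => survival n y).
suff u0 : u x = 0 by rewrite -u0; exact: cv.
apply: liouville => y.
  apply/andP; split.
    by apply: limr_ge; [exact: cv|apply: nearW => n; exact: survival_ge0].
  by apply: limr_le; [exact: cv|apply: nearW => n; exact: survival_le1].
have limS : (\sum_(z <- nbrs y) weight y z * survival n z) @[n --> \oo] -->
    \sum_(z <- nbrs y) weight y z * u z.
  elim: (nbrs y) => [|z s IH].
    under eq_cvg do rewrite big_nil.
    by rewrite big_nil; exact: cvg_cst.
  under eq_cvg do rewrite big_cons.
  by rewrite big_cons; apply: cvgD => //; apply: cvgMr; exact: cv.
rewrite sum_nbrs; under eq_bigr do rewrite mulrBr.
rewrite sumrB -mulr_suml -vertex_weightE lerBrDr -[X in X + _]mul1r -mulrDl mulrC.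
rewrite -(cvg_lim _ limS)//; apply: limr_ge; first by apply/cvg_ex; eexists; exact: limS.
apply: nearW => n; rewrite -survivalS ler_pM2r//.
exact: nonincreasing_cvgn_ge.
Qed.

End survival.

Theorem theorem1p2 (R : realType) (Gamma : weighted_graph R)
    (rho : Gamma -> Gamma -> R)
    (rho_metric : is_metric rho)
    (rho_jump : exists c : R, 0 < c /\
       forall x y : Gamma, edge x y -> rho x y <= c)
    (rho_adapted : exists C : R, 0 < C /\
       forall x : Gamma,
         \sum_(y \in neighbors x) weight x y * rho x y ^+ 2 <= C)
    (growth : exists (x0 : Gamma) (r0 : R),
       0 <= r0 /\ growth_diverges rho x0 r0) :
  stochastically_complete Gamma.
Proof.
case: rho_jump rho_adapted growth => c [c0 rc] [C [C0 rC]] [x0 [r0 [r00 div]]].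
move=> x d Omega P Y S walk t t0; apply: (esum_vsrw_at walk t0) => e e0.
have /cvgr0_norm_le/(_ e e0)[N _ HN] := survival_cvg0
  (fun u => bounded_subsolution_eq0 rho_metric c0 C0 rc rC r00 div) x.
exists N; apply: (le_trans (ler_norm _)); exact: (HN N.+1 (leqnSn N)).
Qed.
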